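(* Let $d\in\{2,3\}$, $T>0$, $\mu>0$, and let either $\Omega=[0,1]^d$ be the torus (periodic boundary condition) or $\Omega\subset\mathbb{R}^d$ be a bounded Lipschitz domain (no-slip boundary condition). Let $0=t_0<t_1<\dots<t_N=T$ be a partition with stepsizes $\tau_n=t_n-t_{n-1}$, let $u_0\in\dot L^2$, and let $u_n$, $n=1,\dots,N$, be the numerical solution given by $$u_n+\tau_nP_X\big[e^{\tau_n\mu A}u_{n-1}\cdot\nabla u_n\big]=e^{\tau_n\mu A}u_{n-1},\qquad n=1,\dots,N.$$ Then $\|u_n\|_{L^2}\le\|u_{n-1}\|_{L^2}$ for all $1\le n\le N$.
   Context: Periodic case: $\dot L^2=\{v\in L^2(\Omega)^d:\nabla\cdot v=0\}$ and $\dot H^2=\{v\in H^2(\Omega)^d:\nabla\cdot v=0\}$, all functions being periodic. No-slip case: $\dot L^2=\{v\in L^2(\Omega)^d:\nabla\cdot v=0,\ v\cdot\nu=0\text{ on }\partial\Omega\}$, with $\nu$ the unit outward normal, and $\dot H^2=\{v\in (H^1_0(\Omega)\cap H^2(\Omega))^d:\nabla\cdot v=0\}$. $P_X:L^2(\Omega)^d\to\dot L^2$ is the $L^2$-orthogonal projection, and $A=P_X\Delta$ on $\dot H^2$ is the Stokes operator with values in $\dot L^2$; $e^{tA}$, $t\ge0$, denotes the (contraction, analytic) Stokes semigroup on $\dot L^2$ that it generates. The expression $w\cdot\nabla v$ denotes $\sum_jw_j\partial_jv$. The numerical solution is understood to satisfy $u_n\in\dot L^2\cap H^1(\Omega)^d$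 for $n\ge1$, with the defining equation holding when tested in the $L^2$ inner product against every $v\in\dot L^2\cap H^1(\Omega)^d$. *)

(* Defs.v *)
From HB Require Import structures.
From mathcomp Require Import all_boot all_order all_algebra.
From mathcomp Require Import all_classical all_reals all_analysis.

Set Implicit Arguments.
Unset Strict Implicit.
Unset Printing Implicit Defensive.
Import Order.TTheory GRing.Theory Num.Theory.
Import numFieldNormedType.Exports.
Local Open Scope classical_set_scope.
Local Open Scope ring_scope.

(** [R^n] is ['rV[R]_n] with the product sigma-algebra; the Lebesgue measure
    is the [n]-fold product of [lebesgue_measure], built one coordinate at a
    time. *)

Section measurable_rV.
Context {R : realType} (n : nat).

Definition coords (i : 'I_n) (x : 'rV[R]_n) : R := x ord0 i.

Let rV_set0 : g_sigma_preimage coords set0.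
Proof. exact: sigma_algebra0. Qed.

Let rV_setC A : g_sigma_preimage coords A -> g_sigma_preimage coords (~` A).
Proof. exact: sigma_algebraC. Qed.

Let rV_bigcup (F : (set 'rV[R]_n)^nat) :
  (forall i, g_sigma_preimage coords (F i)) ->
  g_sigma_preimage coords (\bigcup_i (F i)).
Proof. exact: sigma_algebra_bigcup. Qed.

Definition rV_display : measure_display. Proof. exact: default_measure_display. Qed.

HB.instance Definition _ := @isMeasurable.Build rV_display 'rV[R]_n
  (g_sigma_preimage coords) rV_set0 rV_setC rV_bigcup.

End measurable_rV.

Lemma measurable_coord (R : realType) n (i : 'I_n) :
  measurable_fun [set: 'rV[R]_n] (fun x => x ord0 i).
Proof.
move=> _ A mA; rewrite setTI; apply: sub_sigma_algebra.
case: n i => [[] []//|n i].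
rewrite -bigcup_mkord_ord; exists i; first exact: ltn_ord.
by exists A => //; rewrite inord_val setTI.
Qed.

Lemma measurable_rVP (R : realType) n d (T : measurableType d)
    (f : T -> 'rV[R]_n) :
  (forall i, measurable_fun [set: T] (fun x => f x ord0 i)) ->
  measurable_fun [set: T] f.
Proof.
move=> mf; have H : g_sigma_preimage (fun i => @coords R n i \o f) `<=` measurable.
  apply: smallest_sub; first exact: sigma_algebra_measurable.
  case: n => [|n] in f mf *; first by rewrite big_ord0.
  rewrite -bigcup_mkord_ord; apply: bigcup_sub => i Ii.
  by move=> A [B mB <-]; exact: mf.
move=> _ A mA; apply: H; rewrite g_sigma_preimage_comp.
by exists A.
Qed.

Definition cons_rV (R : realType) n (p : 'rV[R]_n * R) : 'rV[R]_n.+1 :=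
  \row_i oapp (p.1 ord0) p.2 (unlift ord0 i).

Section leb.
Context {R : realType}.

Lemma measurable_cons_rV n :
  measurable_fun [set: 'rV[R]_n * R] (@cons_rV R n).
Proof.
apply: measurable_rVP => i.
rewrite (_ : (fun _ => _) =
  fun p : 'rV[R]_n * R => oapp (p.1 ord0) p.2 (unlift ord0 i)); last first.
  by apply/funext => p; rewrite mxE.
case: unliftP => [j _|_] /=; last exact: measurable_snd.
by apply: (measurableT_comp (measurable_coord j)); exact: measurable_fst.
Qed.

Definition leb_cons n (m : {measure set 'rV[R]_n -> \bar R}) :=
  pushforward (m \x lebesgue_measure)%E (@cons_rV R n).

HB.instance Definition _ n m := Measure.copy (@leb_cons n m)
  (measure_function_pushforward__canonical__measure_function_Measure
    (m \x lebesgue_measure)%E (@measurable_cons_rV n)).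

Fixpoint leb n : {measure set 'rV[R]_n -> \bar R} :=
  match n with
  | 0 => dirac (0 : 'rV[R]_0)
  | n.+1 => leb_cons (leb n)
  end.
End leb.

Section domains.
Context {R : realType} {d : nat}.
Local Notation E := 'rV[R]_d.

Definition basis_vec (j : 'I_d) : E := delta_mx ord0 j.

(** [Torus] is the periodic problem on [[0,1]^d]; [NoSlip Omega] the no-slip
    problem in [Omega]. *)
Variant flow_domain := Torus | NoSlip of set E.

(** Functions on the torus are represented by periodic functions on [R^d], and
    integrated over one period. *)
Definition region (b : flow_domain) : set E :=
  match b with
  | Torus => [set x | forall i, 0 <= x ord0 i <= 1]
  | NoSlip Omega => Omega
  end.

(** In a neighbourhood of each boundary point, and in suitable orthonormal
    coordinates [y = z *m Q], the open set is the strict epigraph over the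
    coordinates other than [y_i] of a Lipschitz function. *)
Definition lipschitz_boundary (Omega : set E) : Prop :=
  forall x, (closure Omega `\` Omega) x ->
  exists (Q : 'M[R]_d) (i : 'I_d) (g : 'rV[R]_d.-1 -> R) (k : R),
  [/\ Q *m Q^T = 1%:M, k.-lipschitz g &
     \forall z \near x, Omega z <-> g (col' i (z *m Q)) < (z *m Q) ord0 i].

Definition bounded_lipschitz_domain (Omega : set E) : Prop :=
  [/\ Omega !=set0, open Omega, connected Omega, bounded_set Omega &
     lipschitz_boundary Omega].

Definition admissible (b : flow_domain) : Prop :=
  if b is NoSlip Omega then bounded_lipschitz_domain Omega else True.

Definition periodic (f : E -> R) : Prop :=
  forall x j, f (x + basis_vec j) = f x.

(** Iterated partial derivatives; [dpartial [:: i; j] f] is d_i d_j f. *)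
Definition dpartial (a : seq 'I_d) (f : E -> R) : E -> R :=
  foldr (fun j g x => derive g x (basis_vec j)) f a.

Definition smooth_on (U : set E) (f : E -> R) : Prop :=
  forall a x, U x -> {for x, continuous (dpartial a f)} /\
    forall j, derivable (dpartial a f) x (basis_vec j).

Definition smooth (b : flow_domain) (f : E -> R) : Prop :=
  match b with
  | Torus => smooth_on setT f /\ periodic f
  | NoSlip Omega => smooth_on Omega f
  end.

Definition test_fun (b : flow_domain) (f : E -> R) : Prop :=
  match b with
  | Torus => smooth_on setT f /\ periodic f
  | NoSlip Omega => smooth_on setT f /\
      exists K, [/\ compact K, K `<=` Omega & forall x, ~ K x -> f x = 0]
  end.

Definition L2 (b : flow_domain) (f : E -> R) : Prop :=
  [/\ measurable_fun (region b) f,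
     (leb d).-integrable (region b) (fun x => (f x ^+ 2)%:E) &
     if b is Torus then periodic f else True].

Definition ip (b : flow_domain) (f g : E -> R) : R :=
  \int[leb d]_(x in region b) (f x * g x).

Definition cvg_L2 (b : flow_domain) (f : nat -> E -> R) (g : E -> R) : Prop :=
  (fun k => Num.sqrt (ip b (f k - g) (f k - g))) @ \oo --> (0 : R).

(** [sobolev_jet b C m f D]: [f] is in the closure of the class [C] in the
    [H^m] norm and, for [|a| <= m], [D a] is its (generalized) derivative of
    multi-index [a]. *)
Definition sobolev_jet (b : flow_domain) (C : (E -> R) -> Prop) (m : nat)
    (f : E -> R) (D : seq 'I_d -> E -> R) : Prop :=
  [/\ D [::] = f,
     forall a, (size a <= m)%N -> L2 b (D a) &
     exists phi : nat -> E -> R, (forall k, C (phi k)) /\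
       forall a, (size a <= m)%N ->
         (forall k, L2 b (dpartial a (phi k))) /\
         cvg_L2 b (fun k => dpartial a (phi k)) (D a)].

(** [H^m] as the completion of the smooth functions of finite [H^m] norm, and
    [H^1_0] as the [H^1]-closure of the test functions. *)
Definition Hm_jet (b : flow_domain) := sobolev_jet b (smooth b).

Definition Hm (b : flow_domain) (m : nat) (f : E -> R) : Prop :=
  exists D, Hm_jet b m f D.

Definition H10 (b : flow_domain) (f : E -> R) : Prop :=
  exists D, sobolev_jet b (test_fun b) 1 f D.

Definition vfield := E -> E.

Definition comp (i : 'I_d) (v : vfield) : E -> R := fun x => v x ord0 i.

Definition vL2 (b : flow_domain) (v : vfield) : Prop :=
  forall i, L2 b (comp i v).

Definition vHm (b : flow_domain) (m : nat) (v : vfield) : Prop :=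
  forall i, Hm b m (comp i v).

Definition vip (b : flow_domain) (v w : vfield) : R :=
  \sum_(i < d) ip b (comp i v) (comp i w).

Definition vnorm (b : flow_domain) (v : vfield) : R := Num.sqrt (vip b v v).

(** Divergence in the sense of distributions. *)
Definition div_free (b : flow_domain) (v : vfield) : Prop :=
  forall phi, test_fun b phi ->
    \sum_(i < d) ip b (comp i v) (dpartial [:: i] phi) = 0.

(** The normal trace of an [L^2] field [v] with square integrable divergence is
    the functional on traces of [H^1] functions given by Green's formula
    [<v . nu, g> = (v, grad g) + (div v, g)]; this is its vanishing when
    [div v = 0]. *)
Definition zero_normal_trace (b : flow_domain) (v : vfield) : Prop :=
  forall g D, Hm_jet b 1 g D ->
    \sum_(i < d) ip b (comp i v) (D [:: i]) = 0.

Definition dotL2 (b : flow_domain) (v : vfield) : Prop :=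
  [/\ vL2 b v, div_free b v &
     if b is NoSlip _ then zero_normal_trace b v else True].

Definition dotH2 (b : flow_domain) (v : vfield) : Prop :=
  [/\ vHm b 2 v, div_free b v &
     if b is NoSlip _ then forall i, H10 b (comp i v) else True].

(** [leray b f p]: [f] is square integrable and [p = P_X f]. *)
Definition leray (b : flow_domain) (f p : vfield) : Prop :=
  [/\ vL2 b f, dotL2 b p & forall v, dotL2 b v -> vip b (f - p) v = 0].

(** Graph of [A = P_X Delta] with domain [dotH2]. *)
Definition stokes (b : flow_domain) (v g : vfield) : Prop :=
  dotH2 b v /\
  exists D : 'I_d -> seq 'I_d -> E -> R,
    (forall i, Hm_jet b 2 (comp i v) (D i)) /\
    leray b (fun x => \row_i \sum_(j < d) D i [:: j; j] x) g.

(** Graph of the infinitesimal generator of [S] on [dotL2]. *)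
Definition generator (b : flow_domain) (S : R -> vfield -> vfield)
    (v g : vfield) : Prop :=
  [/\ dotL2 b v, dotL2 b g &
     (fun h => vnorm b (h^-1 *: (S h v - v) - g)) @ 0^'+ --> (0 : R)].

(** [S t] is [e^{tA}]: a strongly continuous contraction semigroup on [dotL2]
    (elements of which are identified when equal a.e.) whose generator extends
    [A].  If [A] itself generates a contraction semigroup, the generator is
    then exactly [A], and [S] is unique; when [Omega] is not regular enough for
    this, the generator has to be an extension of [A]. *)
Record stokes_semigroup (b : flow_domain) (S : R -> vfield -> vfield) : Prop := {
  semigroup_dotL2 : forall t u, 0 <= t -> dotL2 b u -> dotL2 b (S t u);
  semigroup_linear : forall t (c : R) u v, 0 <= t -> dotL2 b u -> dotL2 b v ->
    S t (c *: u + v) = c *: S t u + S t v %[ae leb d in region b];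
  semigroup_0 : forall u, dotL2 b u -> S 0 u = u %[ae leb d in region b];
  semigroup_add : forall s t u, 0 <= s -> 0 <= t -> dotL2 b u ->
    S (s + t) u = S s (S t u) %[ae leb d in region b];
  semigroup_continuous : forall u, dotL2 b u ->
    (fun h => vnorm b (S h u - u)) @ 0^'+ --> (0 : R);
  semigroup_contraction : forall t u, 0 <= t -> dotL2 b u ->
    vnorm b (S t u) <= vnorm b u;
  semigroup_generator : forall v g, stokes b v g -> generator b S v g }.

(** [w . grad v], where [D i] are the derivatives of [v_i]. *)
Definition convection (w : vfield) (D : 'I_d -> seq 'I_d -> E -> R) : vfield :=
  fun x => \row_i \sum_(j < d) w x ord0 j * D i [:: j] x.

(** [u1 + tau P_X [w . grad u1] = w], tested against solenoidal [H^1] fields. *)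
Definition scheme_step (b : flow_domain) (tau : R) (w u1 : vfield) : Prop :=
  [/\ dotL2 b u1, vHm b 1 u1 &
     exists (D : 'I_d -> seq 'I_d -> E -> R) (p : vfield),
     [/\ forall i, Hm_jet b 1 (comp i u1) (D i),
        leray b (convection w D) p &
        forall v, dotL2 b v -> vHm b 1 v ->
          vip b (u1 + tau *: p) v = vip b w v]].

End domains.

Arguments flow_domain : clear implicits.
Arguments vfield : clear implicits.

(* Main.v *)
Require Import Defs.
From mathcomp Require Import all_boot all_order all_algebra.
From mathcomp Require Import all_classical all_reals all_analysis.
From mathcomp Require Import measurable_realfun.
From mathcomp Require Import ring lra.
Import Order.TTheory GRing.Theory Num.Theory.
Import numFieldNormedType.Exports.
Local Open Scope classical_set_scope.
Local Open Scope ring_scope.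

Set Implicit Arguments.
Unset Strict Implicit.
Unset Printing Implicit Defensive.

(** Testing one step [u1 + tau P_X [w . grad u1] = w], where
    [w = e^{tau mu A} u0], against [u1] itself gives
    [|u1|^2 + tau (w . grad u1, u1) = (w, u1)], because [u1] is solenoidal and
    the Leray projection is orthogonal.  Once the trilinear term vanishes,
    Young's inequality gives [|u1| <= |w|], and [|w| <= |u0|] is the contraction
    property of the Stokes semigroup.

    The trilinear term is the sum over the components [f] of [u1] of
    [\int (w . grad f) f = \int w . grad (f^2 / 2)], formally zero since [w] is
    solenoidal and tangential to the boundary.  However [w] is merely square
    integrable and [f^2 / 2] is in general not in [H^1], so it is not an
    admissible test function for the weak conditions on [w].  It is replaced by
    [Phi_e (f)] with [Phi_e s = s^2 / (2 (1 + e s^2))], called [potential e]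
    below.  Its derivative [saturate e s = s / (1 + e s^2)^2] is bounded and
    Lipschitz, so [Phi_e (f)] is in [H^1] with gradient
    [saturate e (f) grad f] ([Hm_jet_potential]), and
    [\int (w . grad f) saturate e (f) = 0]
    ([solenoidal_orthogonal_gradient]).  As [e] tends to 0, [saturate e (f)]
    tends to [f] in [L^2] ([cvg_l2_saturate]), while [w . grad f] is square
    integrable, as is implicit in applying the projection to it; hence
    [\int (w . grad f) f = 0] ([transport_energy0]).

    Membership of [Phi_e (f)] in [H^1] is a strong approximation by smooth
    functions: if [phi_k] approximates [f], then [Phi_e (phi_k)] approximates
    [Phi_e (f)].  The convergence of the gradients needs
    [(theta (phi_k) - theta (f)) grad f --> 0] in [L^2] for a bounded Lipschitz
    [theta], which is obtained by splitting [grad f] into its saturation, which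
    is bounded, and a remainder small in [L^2] ([cvg_l2_bounded_mul]). *)

(** * Square integrable functions *)

Section square_integrable.
Context {disp : measure_display} {T : measurableType disp} {R : realType}.
Variables (mu : {measure set T -> \bar R}) (D : set T).
Hypothesis mD : measurable D.
Implicit Types f g h : T -> R.

Definition sqint f : Prop :=
  measurable_fun D f /\ mu.-integrable D (fun x => (f x ^+ 2)%:E).

Definition l2dot f g : R := \int[mu]_(x in D) (f x * g x).

Definition l2norm f : R := Num.sqrt (l2dot f f).

Lemma integrable_le (f g : T -> R) : measurable_fun D f ->
  (forall x, D x -> `|f x| <= g x) ->
  mu.-integrable D (EFin \o g) -> mu.-integrable D (EFin \o f).
Proof.
move=> mf fg; apply: le_integrable => //; first exact/measurable_EFinP.
move=> x Dx /=; rewrite lee_fin; apply: (le_trans (fg x Dx)).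
exact: ler_norm.
Qed.

Lemma integrableDr f g : mu.-integrable D (EFin \o f) ->
  mu.-integrable D (EFin \o g) -> mu.-integrable D (EFin \o (fun x => f x + g x)).
Proof. by move=> If Ig; exact: (integrableD mD If Ig). Qed.

Lemma integrableZr (c : R) f : mu.-integrable D (EFin \o f) ->
  mu.-integrable D (EFin \o (fun x => c * f x)).
Proof. by move=> If; exact: (integrableZl mD c If). Qed.

Lemma sqintM f g : sqint f -> sqint g ->
  mu.-integrable D (EFin \o (fun x => f x * g x)).
Proof.
move=> [mf If] [mg Ig]; apply: (integrable_le (measurable_funM mf mg) _
  (integrableDr If Ig)).
move=> x _; rewrite normrM -(real_normK (num_real (f x))).
rewrite -(real_normK (num_real (g x))); nra.
Qed.

Lemma sqint_le (C : R) f h : measurable_fun D h ->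
  (forall x, D x -> `|h x| <= C * `|f x|) -> sqint f -> sqint h.
Proof.
move=> mh hf [mf If]; split => //.
apply: (integrable_le (f := fun x => h x ^+ 2) _ _ (integrableZr (C ^+ 2) If)).
  exact: measurable_funX.
move=> x Dx; rewrite normrX -(real_normK (num_real (f x))) -exprMn.
by rewrite lerXn2r ?nnegrE ?hf //; exact: le_trans (hf x Dx).
Qed.

Lemma sqintZ (c : R) f : sqint f -> sqint (fun x => c * f x).
Proof.
move=> sf; apply: (@sqint_le `|c| f) => //; last by move=> x _; rewrite normrM.
by apply: measurable_funM; [exact: measurable_cst|case: sf].
Qed.

Lemma sqintD f g : sqint f -> sqint g -> sqint (f + g).
Proof.
move=> [mf If] [mg Ig]; split; first exact: measurable_funD.
apply: (integrable_le (f := fun x => (f x + g x) ^+ 2) _ _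
  (integrableDr (integrableZr 2 If) (integrableZr 2 Ig))).
  by apply: measurable_funX; exact: measurable_funD.
move=> x _; rewrite ger0_norm ?sqr_ge0 //.
have := sqr_ge0 (f x - g x); nra.
Qed.

Lemma sqintB f g : sqint f -> sqint g -> sqint (f - g).
Proof.
move=> sf sg; rewrite (_ : f - g = f + (fun x => -1 * g x)).
  exact/sqintD/sqintZ.
by apply/funext => x; rewrite !fctE mulN1r.
Qed.

Lemma l2dotC f g : l2dot f g = l2dot g f.
Proof. by rewrite /l2dot; under eq_Rintegral do rewrite mulrC. Qed.

Lemma l2dotDl f g h : sqint f -> sqint g -> sqint h ->
  l2dot (f + g) h = l2dot f h + l2dot g h.
Proof.
move=> sf sg sh; rewrite /l2dot -RintegralD //; try exact: sqintM.
by apply: eq_Rintegral => x _; rewrite mulrDl.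
Qed.

Lemma l2dotBl f g h : sqint f -> sqint g -> sqint h ->
  l2dot (f - g) h = l2dot f h - l2dot g h.
Proof.
move=> sf sg sh; rewrite /l2dot -RintegralB //; try exact: sqintM.
by apply: eq_Rintegral => x _; rewrite mulrBl.
Qed.

Lemma l2dotZl (c : R) f g : sqint f -> sqint g ->
  l2dot (fun x => c * f x) g = c * l2dot f g.
Proof.
move=> sf sg; rewrite /l2dot -RintegralZl //; last exact: sqintM.
by apply: eq_Rintegral => x _; rewrite mulrA.
Qed.

Lemma l2dot_ge0 f : 0 <= l2dot f f.
Proof. by apply: Rintegral_ge0 => x _; rewrite -expr2 sqr_ge0. Qed.

Lemma l2norm_ge0 f : 0 <= l2norm f.
Proof. exact: sqrtr_ge0. Qed.

Lemma sqr_l2norm f : l2norm f ^+ 2 = l2dot f f.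
Proof. by rewrite sqr_sqrtr // l2dot_ge0. Qed.

(** A nonnegative quadratic polynomial in [c]: both the Cauchy-Schwarz
    inequality and Young's inequality are read off from it. *)
Lemma l2dotDZ (c : R) f g : sqint f -> sqint g ->
  l2dot (f + (fun x => c * g x)) (f + (fun x => c * g x)) =
  l2dot f f + 2 * c * l2dot f g + c ^+ 2 * l2dot g g.
Proof.
move=> sf sg; have scg := sqintZ c sg; have sfg := sqintD sf scg.
rewrite l2dotDl // !(l2dotC _ (f + _)) !l2dotDl //.
rewrite !l2dotZl // (l2dotC f (fun x => c * g x)) (l2dotC g (fun x => c * g x)).
by rewrite !l2dotZl // (l2dotC g f); ring.
Qed.

Lemma cauchy_schwarz f g : sqint f -> sqint g ->
  `|l2dot f g| <= l2norm f * l2norm g.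
Proof.
move=> sf sg; rewrite -(@ler_pXn2r _ 2) ?nnegrE ?mulr_ge0 ?l2norm_ge0 //.
rewrite exprMn !sqr_l2norm real_normK ?num_real //.
have pos c : 0 <= l2dot f f + 2 * c * l2dot f g + c ^+ 2 * l2dot g g.
  by rewrite -l2dotDZ // l2dot_ge0.
have := l2dot_ge0 g; rewrite le0r => /orP[/eqP g0|g0].
  have [->|fg0] := eqVneq (l2dot f g) 0; first by rewrite expr0n mulr_ge0 ?l2dot_ge0.
  (* The quadratic is affine here: this value of its variable makes it -1. *)
  have := pos (- (l2dot f f + 1) / (2 * l2dot f g)); rewrite g0 mulr0 addr0.
  rewrite (_ : 2 * _ * _ = - (l2dot f f + 1)); first lra.
  by field.
(* The minimum of the quadratic. *)
have := pos (- l2dot f g / l2dot g g).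
rewrite (_ : _ + _ + _ = (l2dot f f * l2dot g g - l2dot f g ^+ 2) / l2dot g g).
  by rewrite pmulr_lge0 ?invr_gt0 // subr_ge0.
by field; rewrite gt_eqF.
Qed.

Lemma ler_l2normD f g : sqint f -> sqint g ->
  l2norm (f + g) <= l2norm f + l2norm g.
Proof.
move=> sf sg; rewrite -(@ler_pXn2r _ 2) ?nnegrE ?addr_ge0 ?l2norm_ge0 //.
have -> : f + g = f + (fun x => 1 * g x) by apply/funext => x; rewrite !fctE mul1r.
rewrite sqr_l2norm l2dotDZ // sqrrD !sqr_l2norm.
have := cauchy_schwarz sf sg; have := ler_norm (l2dot f g); lra.
Qed.

Lemma ler_l2norm (C : R) f h : 0 <= C -> sqint f -> sqint h ->
  (forall x, D x -> `|h x| <= C * `|f x|) -> l2norm h <= C * l2norm f.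
Proof.
move=> C0 sf sh hf; rewrite -(@ler_pXn2r _ 2) ?nnegrE ?mulr_ge0 ?l2norm_ge0 //.
rewrite exprMn !sqr_l2norm /l2dot -RintegralZl //; last exact: sqintM.
apply: le_Rintegral => //; [exact: sqintM|exact/integrableZr/sqintM|].
move=> x Dx; rewrite -!expr2 -(real_normK (num_real (h x))).
rewrite -(real_normK (num_real (f x))) -exprMn.
by rewrite lerXn2r ?nnegrE ?mulr_ge0 ?hf.
Qed.

Lemma cvg_l2dot (w g : T -> R) (g_ : nat -> T -> R) :
  sqint w -> sqint g -> (forall k, sqint (g_ k)) ->
  (fun k => l2norm (g_ k - g)) @ \oo --> (0 : R) ->
  (fun k => l2dot (g_ k) w) @ \oo --> l2dot g w.
Proof.
move=> sw sg sg_ gg; apply/subr_cvg0.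
have gw0 : (fun k => l2norm (g_ k - g) * l2norm w) @ \oo --> (0 : R).
  by rewrite -[X in _ --> X](mul0r (l2norm w)); apply: (cvgM gg); exact: cvg_cst.
apply: (squeeze_cvgr _ _ gw0); last by rewrite -[X in _ --> X]oppr0; exact: cvgN gw0.
near=> k; rewrite -ler_norml -l2dotBl //.
by apply: cauchy_schwarz => //; exact: sqintB.
Unshelve. all: by end_near. Qed.

Lemma integrable_Rsum (I : Type) (s : seq I) (F : I -> T -> R) :
  (forall i, mu.-integrable D (EFin \o F i)) ->
  mu.-integrable D (EFin \o (fun x => \sum_(i <- s) F i x)).
Proof.
move=> iF; elim: s => [|i s IH].
  rewrite (_ : _ \o _ = fun=> 0%E); first exact: integrable0.
  by apply/funext => x /=; rewrite big_nil.
rewrite (_ : _ \o _ = EFin \o (fun x => F i x + \sum_(i <- s) F i x)).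
  exact: integrableDr.
by apply/funext => x /=; rewrite big_cons.
Qed.

Lemma Rintegral_sum (I : Type) (s : seq I) (F : I -> T -> R) :
  (forall i, mu.-integrable D (EFin \o F i)) ->
  \int[mu]_(x in D) (\sum_(i <- s) F i x) =
  \sum_(i <- s) \int[mu]_(x in D) F i x.
Proof.
move=> iF; elim: s => [|i s IH].
  rewrite big_nil; under eq_Rintegral do rewrite big_nil.
  by rewrite /Rintegral integral0.
rewrite big_cons -IH -RintegralD //; last exact: integrable_Rsum.
by apply: eq_Rintegral => x _; rewrite big_cons.
Qed.

End square_integrable.

(** * Saturation of the identity *)

Section saturation.
Context {R : realType}.
Implicit Types e s t : R.

(** A bounded Lipschitz approximation of the identity as [e] tends to 0.  It is
    rational so that composing it with a smooth function only takes products
    and inverses. *)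
Definition saturate e s : R := s / (1 + e * s ^+ 2) ^+ 2.

(** The primitive [s^2 / (2 (1 + e s^2))] of [saturate e], written with a single
    inverse so that its smoothness and its derivative follow from those of an
    inverse. *)
Definition potential e s : R := (2 * e)^-1 - (2 * e)^-1 * (1 + e * s ^+ 2)^-1.

Lemma saturate_den_gt0 e s : 0 <= e -> 0 < 1 + e * s ^+ 2.
Proof. by move=> e0; rewrite ltr_pwDl // mulr_ge0 ?sqr_ge0. Qed.

Lemma ler_saturate e s : 0 <= e -> `|saturate e s| <= `|s|.
Proof.
move=> e0; have d0 := saturate_den_gt0 s e0.
rewrite normrM normfV (@ger0_norm _ (_ ^+ 2)) ?exprn_ge0 ?(ltW d0) //.
rewrite ler_pdivrMr ?exprn_gt0 // ler_peMr // exprn_ege1 //.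
by rewrite lerDl mulr_ge0 ?sqr_ge0.
Qed.

Lemma saturate_bounded e s : 0 < e <= 1 -> `|saturate e s| <= e^-1.
Proof.
move=> /andP[e0 e1]; have d0 := saturate_den_gt0 s (ltW e0).
rewrite normrM normfV (@ger0_norm _ (_ ^+ 2)) ?exprn_ge0 ?(ltW d0) //.
rewrite ler_pdivrMr ?exprn_gt0 // mulrC ler_pdivlMr //.
(* [e |s| <= (e + e s^2) / 2 <= 1 + e s^2], where [e <= 1]. *)
rewrite -(real_normK (num_real s)).
have : 0 <= e * (`|s| - 1) ^+ 2 by rewrite mulr_ge0 ?sqr_ge0 ?ltW.
have : 0 <= e * `|s| ^+ 2 by rewrite mulr_ge0 ?sqr_ge0 ?ltW.
have := sqr_ge0 (e * `|s| ^+ 2); lra.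
Qed.

(** With [p = 1 + e s^2] and [q = 1 + e t^2], the difference quotient is
    [p^-2 - e t (s + t) (p + q) / (p^2 q^2)], whose terms are at most 1 and 3 in
    absolute value. *)
Lemma saturate_lipschitz e s t : 0 < e ->
  `|saturate e s - saturate e t| <= 4 * `|s - t|.
Proof.
move=> e0; have ds := saturate_den_gt0 s (ltW e0).
have dt := saturate_den_gt0 t (ltW e0).
rewrite /saturate; set p := 1 + e * s ^+ 2 in ds *.
set q := 1 + e * t ^+ 2 in dt *.
have -> : s / p ^+ 2 - t / q ^+ 2 =
    (p ^- 2 - e * t * (s + t) * (p + q) / (p ^+ 2 * q ^+ 2)) * (s - t).
  by rewrite /p /q; field; rewrite !gt_eqF.
rewrite normrM ler_wpM2r //.
have p1 : 1 <= p by rewrite lerDl mulr_ge0 ?sqr_ge0 ?ltW.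
have q1 : 1 <= q by rewrite lerDl mulr_ge0 ?sqr_ge0 ?ltW.
have p20 : 0 < p ^+ 2 by rewrite exprn_gt0.
have q20 : 0 < q ^+ 2 by rewrite exprn_gt0.
apply: (le_trans (ler_normB _ _)).
have : `|p ^- 2| <= 1.
  by rewrite normfV (ger0_norm (ltW p20)) invf_le1 // exprn_ege1.
have : `|e * t * (s + t) * (p + q) / (p ^+ 2 * q ^+ 2)| <= 3.
  rewrite normrM normfV (ger0_norm (ltW (mulr_gt0 p20 q20))).
  rewrite ler_pdivrMr ?mulr_gt0 //.
  have a1 : `|e * t * (s + t)| <= (3 / 2) * (p * q).
    (* [e t (s + t)] is a combination of [e s^2], [e t^2] and [e (s + t)^2]. *)
    have -> : (3 / 2) * (p * q) = (3 / 2) + (3 / 2) * e * s ^+ 2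
        + (3 / 2) * e * t ^+ 2 + (3 / 2) * (e * s * t) ^+ 2.
      by rewrite /p /q; ring.
    have : 0 <= e * (s - t) ^+ 2 by rewrite mulr_ge0 ?sqr_ge0 ?ltW.
    have : 0 <= e * (s + t) ^+ 2 by rewrite mulr_ge0 ?sqr_ge0 ?ltW.
    have : 0 <= e * s ^+ 2 by rewrite mulr_ge0 ?sqr_ge0 ?ltW.
    have : 0 <= e * t ^+ 2 by rewrite mulr_ge0 ?sqr_ge0 ?ltW.
    have := sqr_ge0 (e * s * t).
    rewrite ler_norml; nra.
  have a2 : `|p + q| <= 2 * (p * q) by rewrite ger0_norm; nra.
  rewrite normrM -exprMn.
  have -> : 3 * (p * q) ^+ 2 = 3 / 2 * (p * q) * (2 * (p * q)) by field.
  by rewrite ler_pM.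
lra.
Qed.

Lemma potential0 e : potential e 0 = 0.
Proof. by rewrite /potential expr0n mulr0 addr0 invr1 mulr1 subrr. Qed.

Lemma potential_lipschitz e s t : 0 < e <= 1 ->
  `|potential e s - potential e t| <= e^-1 * `|s - t|.
Proof.
move=> /andP[e0 e1]; have ds := saturate_den_gt0 s (ltW e0).
have dt := saturate_den_gt0 t (ltW e0).
have -> : potential e s - potential e t =
    (s + t) / (2 * ((1 + e * s ^+ 2) * (1 + e * t ^+ 2))) * (s - t).
  by rewrite /potential; field; rewrite !gt_eqF.
rewrite normrM ler_wpM2r // normrM normfV.
rewrite (@ger0_norm _ (2 * _)); last by rewrite !mulr_ge0 ?ltW.
rewrite ler_pdivrMr ?mulr_gt0 // mulrC ler_pdivlMr //.
have es : 0 <= e * s ^+ 2 by rewrite mulr_ge0 ?sqr_ge0 ?ltW.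
have et : 0 <= e * t ^+ 2 by rewrite mulr_ge0 ?sqr_ge0 ?ltW.
have := mulr_ge0 es et; move: es et.
have : 0 <= e * (s - 1) ^+ 2 by rewrite mulr_ge0 ?sqr_ge0 ?ltW.
have : 0 <= e * (s + 1) ^+ 2 by rewrite mulr_ge0 ?sqr_ge0 ?ltW.
have : 0 <= e * (t - 1) ^+ 2 by rewrite mulr_ge0 ?sqr_ge0 ?ltW.
have : 0 <= e * (t + 1) ^+ 2 by rewrite mulr_ge0 ?sqr_ge0 ?ltW.
by case: (ger0P (s + t)) => _; lra.
Qed.

Lemma ler_potential e s : 0 < e <= 1 -> `|potential e s| <= e^-1 * `|s|.
Proof. by move=> /(potential_lipschitz s 0); rewrite potential0 !subr0. Qed.

Lemma continuous_saturate e : 0 < e -> continuous (saturate e).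
Proof.
move=> e0 s; apply: cvgM; first exact: cvg_id.
apply: cvgV; first by rewrite expf_neq0 // gt_eqF // saturate_den_gt0 // ltW.
apply: (@cvg_comp _ _ _ (fun y : R => 1 + e * y ^+ 2)
  (fun y : R => y ^+ 2)); last exact: exprn_continuous.
apply: cvgD; first exact: cvg_cst.
by apply: cvgM; [exact: cvg_cst|exact: exprn_continuous].
Qed.

Lemma cvg_saturate s : (fun n => saturate n.+1%:R^-1 s) @ \oo --> s.
Proof.
rewrite -[X in _ --> X](divr1 s) -[X in _ / X](expr1n _ 2).
rewrite -[X in X ^+ 2](addr0 1) -[X in _ + X](mul0r (s ^+ 2)).
apply: cvgM; first exact: cvg_cst.
apply: cvgV; first by rewrite mul0r addr0 expr1n oner_neq0.
apply: (@cvg_comp _ _ _ (fun n => 1 + n.+1%:R^-1 * s ^+ 2)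
  (fun y : R => y ^+ 2)); last exact: exprn_continuous.
apply: cvgD; first exact: cvg_cst.
by apply: cvgM; [exact: cvg_harmonic|exact: cvg_cst].
Qed.

End saturation.

Lemma harmonic_le1 (R : realType) (n : nat) : 0 < (n.+1%:R^-1 : R) <= 1.
Proof. by rewrite invr_gt0 ltr0Sn invf_le1 ?ltr0Sn // ler1n. Qed.

(** * Saturation in the space of square integrable functions *)

Section saturation_in_L2.
Context {disp : measure_display} {T : measurableType disp} {R : realType}.
Variables (mu : {measure set T -> \bar R}) (D : set T).
Hypothesis mD : measurable D.
Implicit Types f g h : T -> R.

Lemma measurable_saturate (e : R) f : 0 < e -> measurable_fun D f ->
  measurable_fun D (saturate e \o f).
Proof.
move=> e0 mf; apply: (@measurableT_comp _ _ _ _ _ _ (saturate e)) => //.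
by apply: continuous_measurable_fun; exact: continuous_saturate.
Qed.

Lemma sqint_saturate (e : R) f : 0 < e -> sqint mu D f ->
  sqint mu D (saturate e \o f).
Proof.
move=> e0 sf; apply: (@sqint_le _ _ _ _ _ mD 1 f) => //.
  by apply: measurable_saturate => //; case: sf.
by move=> x _; rewrite mul1r ler_saturate // ltW.
Qed.

(** Dominated convergence: [|saturate e s| <= |s|] bounds the square of the
    difference by [4 f^2]. *)
Lemma cvg_l2_saturate f : sqint mu D f ->
  (fun n => l2norm mu D (saturate n.+1%:R^-1 \o f - f)) @ \oo --> (0 : R).
Proof.
move=> sf; have [mf If] := sf.
have e0 n : 0 < (n.+1%:R^-1 : R) by rewrite invr_gt0.
have sn n := sqintB mD (sqint_saturate (e0 n) sf) sf.
rewrite -(sqrtr0 R); apply: (@cvg_comp _ _ _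
  (fun n => l2dot mu D (saturate n.+1%:R^-1 \o f - f)
    (saturate n.+1%:R^-1 \o f - f)) Num.sqrt); last exact: sqrt_continuous.
rewrite /l2dot /Rintegral; apply: (@fine_cvg _ _ _ _ _ 0%R).
rewrite -[X in _ --> X](integral0 mu D).
apply: (@dominated_cvg _ _ _ _ _ mD _ _ (fun x => (4 * f x ^+ 2)%:E)).
- by move=> n; apply/measurable_EFinP/measurable_funM; case: (sn n).
- move=> x _; rewrite -[X in _ --> X]/(0%:E).
  apply: cvg_EFin; first by apply: nearW.
  have c0 : (fun n => saturate n.+1%:R^-1 (f x) - f x) @ \oo --> (0 : R).
    by apply/subr_cvg0; exact: cvg_saturate.
  by rewrite -(mulr0 0); exact: cvgM.
- by [].
- exact: (integrableZr mD 4 If).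
- move=> n x _ /=; rewrite lee_fin -expr2 normrX -(real_normK (num_real (f x))).
  rewrite (_ : 4 = 2 ^+ 2); last by ring.
  rewrite -exprMn lerXn2r ?nnegrE ?mulr_ge0 //.
  apply: (le_trans (ler_normB _ _)).
  by have := ler_saturate (f x) (ltW (e0 n)); rewrite /=; lra.
Qed.

(** The difference is the sum of [theta (f) (h - k)],
    [(theta (g) - theta (f)) (saturate e k - k)] and
    [(theta (f) - theta (g)) saturate e k]; the last one is controlled by
    [f - g] because [saturate e k] is bounded by [e^-1]. *)
Lemma l2norm_bounded_mul_le (e M L : R) (theta : R -> R) f g h k :
  0 < e <= 1 -> 0 <= M -> 0 <= L -> measurable_fun setT theta ->
  (forall s, `|theta s| <= M) ->
  (forall s t, `|theta s - theta t| <= L * `|s - t|) ->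
  sqint mu D f -> sqint mu D g -> sqint mu D h -> sqint mu D k ->
  l2norm mu D ((fun x => theta (f x) * h x) - (fun x => theta (g x) * k x)) <=
  M * l2norm mu D (h - k) + 2 * M * l2norm mu D (saturate e \o k - k)
  + L * e^-1 * l2norm mu D (f - g).
Proof.
move=> e01 M0 L0 mtheta thetaM thetaL sf sg sh sk.
have e0 : 0 < e by case/andP: e01.
have sek := sqint_saturate e0 sk.
have mcomp u : sqint mu D u -> measurable_fun D (theta \o u).
  by move=> [mu' _]; exact: (@measurableT_comp _ _ _ _ _ _ theta).
pose a := fun x => theta (f x) * (h - k) x.
pose b := fun x => (theta (g x) - theta (f x)) * (saturate e \o k - k) x.
pose c := fun x => (theta (f x) - theta (g x)) * saturate e (k x).
have -> : (fun x => theta (f x) * h x) - (fun x => theta (g x) * k x) = a + b + c.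
  by apply/funext => x; rewrite /a /b /c !fctE /=; ring.
have shk := sqintB mD sh sk; have skk := sqintB mD sek sk.
have sfg := sqintB mD sf sg.
have ale x : D x -> `|a x| <= M * `|(h - k) x|.
  by move=> _; rewrite normrM ler_wpM2r.
have ble x : D x -> `|b x| <= 2 * M * `|(saturate e \o k - k) x|.
  move=> _; rewrite normrM ler_wpM2r //; apply: (le_trans (ler_normB _ _)).
  by have := thetaM (g x); have := thetaM (f x); lra.
have cle x : D x -> `|c x| <= L * e^-1 * `|(f - g) x|.
  move=> _; rewrite normrM mulrAC; apply: ler_pM => //.
  exact: saturate_bounded.
have sa : sqint mu D a.
  apply: (sqint_le mD _ ale) => //.
  by apply: measurable_funM; [exact: mcomp|case: shk].
have sb : sqint mu D b.
  apply: (sqint_le mD _ ble) => //; apply: measurable_funM; last by case: skk.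
  by apply: measurable_funB; exact: mcomp.
have sc : sqint mu D c.
  apply: (sqint_le mD _ cle) => //; apply: measurable_funM; last by case: sek.
  by apply: measurable_funB; exact: mcomp.
apply: (le_trans (ler_l2normD mD (sqintD mD sa sb) sc)); apply: lerD.
  apply: (le_trans (ler_l2normD mD sa sb)); apply: lerD.
    exact: (ler_l2norm mD M0 shk sa ale).
  by apply: (ler_l2norm mD _ skk sb ble); rewrite mulr_ge0.
by apply: (ler_l2norm mD _ sfg sc cle); rewrite mulr_ge0 // invr_ge0 ltW.
Qed.

(** Products of a convergent sequence with bounded Lipschitz functions of
    another one converge in [L^2]: in the preceding bound, [e] is chosen so
    that the middle term is small before [n] goes to infinity. *)
Lemma cvg_l2_bounded_mul (M L : R) (theta : R -> R) (f_ h_ : nat -> T -> R) g k :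
  0 <= M -> 0 <= L -> measurable_fun setT theta ->
  (forall s, `|theta s| <= M) ->
  (forall s t, `|theta s - theta t| <= L * `|s - t|) ->
  (forall n, sqint mu D (f_ n)) -> sqint mu D g ->
  (forall n, sqint mu D (h_ n)) -> sqint mu D k ->
  (fun n => l2norm mu D (f_ n - g)) @ \oo --> (0 : R) ->
  (fun n => l2norm mu D (h_ n - k)) @ \oo --> (0 : R) ->
  (fun n => l2norm mu D
    ((fun x => theta (f_ n x) * h_ n x) - (fun x => theta (g x) * k x)))
    @ \oo --> (0 : R).
Proof.
move=> M0 L0 mtheta thetaM thetaL sf sg sh sk fg hk.
apply/cvgrPdist_le => eps eps0.
have : (fun m => 2 * M * l2norm mu D (saturate m.+1%:R^-1 \o k - k))
    @ \oo --> (0 : R).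
  rewrite -(mulr0 (2 * M)).
  by apply: cvgM; [exact: cvg_cst|exact: cvg_l2_saturate].
have eps20 : 0 < eps / 2 by rewrite divr_gt0.
move=> /cvgrPdist_le /(_ _ eps20) [m _ /(_ m (leqnn m))] /=.
rewrite sub0r normrN => km.
have : (fun n => M * l2norm mu D (h_ n - k) +
    L * (m.+1%:R^-1)^-1 * l2norm mu D (f_ n - g)) @ \oo --> (0 : R).
  have := cvgD (cvgM (cvg_cst M) hk) (cvgM (cvg_cst (L * (m.+1%:R^-1)^-1)) fg).
  by rewrite !mulr0 addr0; apply.
move=> /cvgrPdist_le /(_ _ eps20); apply: filterS => n /=.
rewrite !sub0r !normrN => hn.
rewrite (ger0_norm (l2norm_ge0 _ _ _)).
apply: (le_trans (l2norm_bounded_mul_le (harmonic_le1 R m) M0 L0 mtheta thetaM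
  thetaL (sf n) sg (sh n) sk)).
have := ler_norm (2 * M * l2norm mu D (saturate m.+1%:R^-1 \o k - k)).
have := ler_norm (M * l2norm mu D (h_ n - k) +
    L * (m.+1%:R^-1)^-1 * l2norm mu D (f_ n - g)).
lra.
Qed.

End saturation_in_L2.

(** * Smooth functions on an open set *)

Section smooth_closure.
Context {R : realType} {d : nat}.
Local Notation E := 'rV[R]_d.
Variable U : set E.
Hypothesis oU : open U.
Implicit Types f g : E -> R.

(** The truncation at order [n] of [smooth_on], on which the closure properties
    are proved by induction. *)
Definition smooth_upto (n : nat) f : Prop :=
  forall a, (size a <= n)%N -> forall x, U x ->
    {for x, continuous (dpartial a f)} /\
    forall j, derivable (dpartial a f) x (basis_vec j).

Lemma smooth_onP f : smooth_on U f <-> forall n, smooth_upto n f.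
Proof.
split=> [sf n a _ x Ux|sf a x Ux]; first exact: sf.
exact: (sf (size a) a (leqnn _)).
Qed.

Lemma dpartial_rcons (a : seq 'I_d) i f :
  dpartial (rcons a i) f = dpartial a (dpartial [:: i] f).
Proof. by rewrite /dpartial foldr_rcons. Qed.

Lemma smooth_uptoW m n f : (m <= n)%N -> smooth_upto n f -> smooth_upto m f.
Proof. by move=> mn sf a am; apply: sf; exact: leq_trans mn. Qed.

(** [dpartial] applies the last index of the sequence first, so this peels off
    the innermost derivative: products and inverses are then handled by the
    Leibniz rule and the induction hypothesis. *)
Lemma smooth_uptoS n f : smooth_upto n.+1 f <->
  smooth_upto 0 f /\ forall i, smooth_upto n (dpartial [:: i] f).
Proof.
split=> [sf|[s0 sf]].
  split=> [|i a an]; first exact: smooth_uptoW sf.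
  by rewrite -dpartial_rcons; apply: sf; rewrite size_rcons.
move=> a; case/lastP: a => [_|a i]; first exact: s0.
by rewrite size_rcons ltnS dpartial_rcons; exact: sf.
Qed.

(** Openness of [U] makes the derivatives on [U] depend on the values on [U]
    only. *)
Lemma dpartial_eq f g (a : seq 'I_d) : (forall x, U x -> f x = g x) ->
  forall x, U x -> dpartial a f x = dpartial a g x.
Proof.
elim: a f g => [//|i a IH] f g fg x Ux /=.
apply: near_eq_derive; near=> y; apply: (IH _ _ fg).
by near: y; exact: open_nbhs_nbhs.
Unshelve. all: by end_near. Qed.

Lemma smooth_upto_eq n f g : (forall x, U x -> f x = g x) ->
  smooth_upto n f -> smooth_upto n g.
Proof.
move=> fg sf a an x Ux; have [cf df] := sf a an x Ux.
have e : {near x, dpartial a f =1 dpartial a g}.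
  near=> y; apply: (dpartial_eq a fg).
  by near: y; exact: open_nbhs_nbhs.
split; last by move=> j; apply: (near_eq_derivable e); exact: df.
rewrite /prop_for /continuous_at -(dpartial_eq a fg Ux).
by apply: cvg_trans cf; exact: (@near_eq_cvg _ _ (nbhs x)).
Unshelve. all: by end_near. Qed.

Lemma smooth_upto_cst n (c : R) : smooth_upto n (fun _ => c).
Proof.
elim: n c => [|n IH] c.
  case=> // _ x _; by split; [exact: cst_continuous|move=> j; exact: derivable_cst].
apply/smooth_uptoS; split; first exact: smooth_uptoW (IH c).
move=> i; apply: smooth_upto_eq (IH 0) => x _.
by rewrite /dpartial /= derive_cst.
Qed.

Lemma smooth_uptoD n f g :
  smooth_upto n f -> smooth_upto n g -> smooth_upto n (fun x => f x + g x).
Proof.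
elim: n f g => [|n IH] f g sf sg.
  case=> // _ x Ux; have [cf df] := sf [::] (leqnn _) x Ux.
  have [cg dg] := sg [::] (leqnn _) x Ux.
  by split; [exact: continuousD|move=> j; exact: derivableD].
have /smooth_uptoS[sf0 sf1] := sf; have /smooth_uptoS[sg0 sg1] := sg.
apply/smooth_uptoS; split.
  apply: smooth_uptoW (IH _ _ _ _) => //; exact: smooth_uptoW.
move=> i; apply: smooth_upto_eq (IH _ _ (sf1 i) (sg1 i)) => x Ux.
by rewrite /= deriveD //; [case: (sf0 [::] (leqnn _) x Ux)|case: (sg0 [::] (leqnn _) x Ux)].
Qed.

Lemma smooth_uptoM n f g :
  smooth_upto n f -> smooth_upto n g -> smooth_upto n (fun x => f x * g x).
Proof.
elim: n f g => [|n IH] f g sf sg.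
  case=> // _ x Ux; have [cf df] := sf [::] (leqnn _) x Ux.
  have [cg dg] := sg [::] (leqnn _) x Ux.
  by split; [exact: continuousM|move=> j; exact: derivableM].
have /smooth_uptoS[sf0 sf1] := sf; have /smooth_uptoS[sg0 sg1] := sg.
have sfn := smooth_uptoW (leqnSn n) sf; have sgn := smooth_uptoW (leqnSn n) sg.
apply/smooth_uptoS; split; first exact: smooth_uptoW (IH _ _ sfn sgn).
move=> i; apply: smooth_upto_eq
  (smooth_uptoD (IH _ _ sfn (sg1 i)) (IH _ _ sgn (sf1 i))) => x Ux.
by rewrite /= deriveM //; [case: (sf0 [::] (leqnn _) x Ux)|case: (sg0 [::] (leqnn _) x Ux)].
Qed.

Lemma smooth_uptoV n f : (forall x, f x != 0) ->
  smooth_upto n f -> smooth_upto n (fun x => (f x)^-1).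
Proof.
move=> f0; elim: n => [|n IH] sf.
  case=> // _ x Ux; have [cf df] := sf [::] (leqnn _) x Ux.
  by split; [exact: continuousV|move=> j; exact: derivableV].
have /smooth_uptoS[sf0 sf1] := sf; have sfn := IH (smooth_uptoW (leqnSn n) sf).
apply/smooth_uptoS; split; first exact: smooth_uptoW sfn.
move=> i; have := smooth_uptoM (@smooth_upto_cst n (-1))
  (smooth_uptoM (smooth_uptoM sfn sfn) (sf1 i)).
apply: smooth_upto_eq => x Ux.
rewrite /= deriveV //; last by case: (sf0 [::] (leqnn _) x Ux).
by rewrite /GRing.scale /=; field.
Qed.

Lemma smooth_on_potential (e : R) f : 0 < e -> smooth_on U f ->
  smooth_on U (potential e \o f).
Proof.
move=> e0 /smooth_onP sf; apply/smooth_onP => n; rewrite /potential.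
have sc c := @smooth_upto_cst n c.
have s2 := smooth_uptoM (sc e) (smooth_uptoM (sf n) (sf n)).
have sd := smooth_uptoV (fun x => lt0r_neq0 (saturate_den_gt0 (f x) (ltW e0)))
  (smooth_uptoD (sc 1) s2).
apply: smooth_upto_eq (smooth_uptoD (sc (2 * e)^-1)
  (smooth_uptoM (sc (- (2 * e)^-1)) sd)) => x _ /=.
by rewrite mulNr expr2.
Qed.

Lemma derive_potential (e : R) f x v : 0 < e -> derivable f x v ->
  'D_v (potential e \o f) x = saturate e (f x) * 'D_v f x.
Proof.
move=> e0 df; pose q : E -> R := cst 1 + e *: (f * f).
have q0 : q x != 0.
  by rewrite gt_eqF //; apply: (saturate_den_gt0 (f x) (ltW e0)).
have dff : derivable (f * f) x v := derivableM df df.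
have def := derivableZ (k := e) dff.
have d1 := derivable_cst (1 : R) x v.
have dq : derivable q x v := derivableD d1 def.
have Dq : 'D_v q x = 2 * e * f x * 'D_v f x.
  rewrite (deriveD d1 def) derive_cst (deriveZ e dff) (deriveM df df).
  by rewrite /GRing.scale /=; ring.
have dV := derivableV q0 dq.
have dcV := derivableZ (k := (2 * e)^-1) dV.
have dc := derivable_cst ((2 * e)^-1 : R) x v.
have -> : potential e \o f =
    cst (2 * e)^-1 - (2 * e)^-1 *: ((fun y => (q y)^-1) : E -> R).
  by apply/funext => y; rewrite /potential /q !fctE /= /GRing.scale /= expr2.
rewrite (deriveB dc dcV) derive_cst (deriveZ _ dV) (deriveV q0 dq) Dq.
rewrite (_ : q x = 1 + e * f x ^+ 2); last by rewrite expr2.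
rewrite /saturate /GRing.scale /=.
by field; rewrite !gt_eqF // saturate_den_gt0 // ltW.
Qed.
End smooth_closure.

(** * Borel sets of the coordinate sigma-algebra *)

Section measurable_open.
Context {R : realType} {d : nat}.
Local Notation E := 'rV[R]_d.

Lemma measurable_preimage_coord (i : 'I_d) (A : set R) : measurable A ->
  measurable [set x : E | A (x ord0 i)].
Proof.
move=> mA; rewrite -[X in measurable X]setTI.
exact: (@measurable_coord R d i).
Qed.

Lemma measurable_rV_box (A : 'I_d -> set R) : (forall i, measurable (A i)) ->
  measurable [set x : E | forall i, A i (x ord0 i)].
Proof.
move=> mA.
have -> : [set x : E | forall i, A i (x ord0 i)] =
    \bigcap_(i in [set: 'I_d]) [set x : E | A i (x ord0 i)].
  by apply/seteqP; split=> x Ax i; [move=> _|]; exact: Ax.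
apply: fin_bigcap_measurable => // i _.
exact: measurable_preimage_coord.
Qed.

Lemma measurable_ball_rV (c : E) (r : R) : measurable (ball c r).
Proof.
have [r0|r0] := ltP 0 r; last first.
  rewrite (_ : ball c r = set0) // -subset0 => x [r1 _].
  by move: r1; rewrite ltNge r0.
have -> : ball c r = [set x : E | forall i, ball (c ord0 i) r (x ord0 i)].
  apply/seteqP; split=> [x [_ cx] i|x cx]; first exact: cx.
  by split=> // i j; rewrite !ord1.
apply: (@measurable_rV_box (fun i => ball (c ord0 i) r)) => i.
exact: measurable_ball.
Qed.

(** An open set is the countable union of the balls it contains among those with
    rational centre and radius [1 / (n + 1)], for the sup norm. *)
Lemma open_measurable_rV (U : set E) : open U -> measurable U.
Proof.
move=> oU; pose c (q : 'rV[rat]_d * nat) : E := map_mx ratr q.1.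
pose r (q : 'rV[rat]_d * nat) : R := q.2.+1%:R^-1.
pose F q := if `[< ball (c q) (r q) `<=` U >] then ball (c q) (r q) else set0.
have -> : U = \bigcup_q F q.
  apply/seteqP; split=> [x Ux|x [q _]]; last first.
    by rewrite /F; case: asboolP => // qU /qU.
  have /nbhs_ballP [e /= e0 xeU] := open_nbhs_nbhs (conj oU Ux).
  pose n := Num.truncn (2 / e).
  have n0 : 0 < (n.+1%:R^-1 : R) by rewrite invr_gt0.
  (* A rational ball of radius [1 / (n + 1) <= e / 2] that contains [x] lies in
     the ball of radius [e] about [x]. *)
  have ne : (n.+1%:R^-1 : R) + n.+1%:R^-1 <= e.
    have : (n.+1%:R^-1 : R) < e / 2.
      by rewrite -[e / 2]invf_div ltf_pV2 ?posrE ?divr_gt0 // truncnS_gt.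
    by move=> /ltW h; rewrite [leRHS]splitr lerD.
  have /choice [q qx] : forall i : 'I_d, exists q : rat,
      ball (x ord0 i) n.+1%:R^-1 (ratr q : R).
    move=> i; have [y [xy [q _ qy]]] := @dense_rat R (ball (x ord0 i) n.+1%:R^-1)
      (ex_intro _ _ (ballxx (x ord0 i) n0)) (ball_open (x ord0 i) _).
    by exists q; rewrite qy.
  exists (\row_i q i, n) => //; rewrite /F.
  have cx : ball x n.+1%:R^-1 (c (\row_i q i, n)).
    by split=> // i j; rewrite !ord1 /c !mxE; exact: qx.
  case: asboolP; first by move=> _; exact: ball_sym.
  case; move=> y cy; apply: xeU; apply: le_ball ne _ _.
  exact: ball_triangle cx cy.
apply: countable_bigcupT_measurable => // q.
by rewrite /F; case: ifP => // _; exact: measurable_ball_rV.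
Qed.

End measurable_open.

(** * Functions of class L2 and H1 on a flow domain *)

Section energy.
Context {R : realType} {d : nat}.
Local Notation E := 'rV[R]_d.
Implicit Types (b : flow_domain R d) (f g h : E -> R) (v w p : vfield R d).

(** The open set on which [smooth b] requires the derivatives to exist.  On the
    torus it is the whole space and not the unit cube, since equality of
    periodic functions concerns all of [R^d]. *)
Definition carrier b : set E := if b is NoSlip Omega then Omega else setT.

Lemma open_carrier b : admissible b -> open (carrier b).
Proof. by case: b => [_|Omega [_ oO _ _ _]] //; exact: openT. Qed.

Lemma region_carrier b x : region b x -> carrier b x.
Proof. by case: b. Qed.

Lemma measurable_region b : admissible b -> measurable (region b).
Proof.
case: b => [_|Omega [_ oO _ _ _]]; last exact: open_measurable_rV.
rewrite (_ : region _ = [set x : E | forall i, `[0, 1]%classic (x ord0 i)]).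
  by apply: (@measurable_rV_box R d (fun=> `[0, 1]%classic)).
by apply/seteqP; split=> x /= h i; have := h i; rewrite in_itv.
Qed.

Lemma smooth_carrier b f : smooth b f -> smooth_on (carrier b) f.
Proof. by case: b => [[]|]. Qed.

Lemma L2_sqint b f : L2 b f -> sqint (leb d) (region b) f.
Proof. by case. Qed.

Lemma L2_le b (C : R) f h : admissible b -> measurable_fun (region b) h ->
  (forall x, region b x -> `|h x| <= C * `|f x|) ->
  (if b is Torus then Defs.periodic h else True) -> L2 b f -> L2 b h.
Proof.
move=> /measurable_region mb mh hf ph /L2_sqint sf.
by have [? ?] := sqint_le mb mh hf sf.
Qed.

Lemma L2_eq b f g : admissible b -> (forall x, carrier b x -> f x = g x) ->
  L2 b f -> L2 b g.
Proof.
move=> ab; case: b ab => [_ fg|Omega ab fg fL].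
  by rewrite (_ : g = f) //; apply/funext => x; rewrite fg.
apply: (@L2_le _ 1 f) => //; last by move=> x Ox; rewrite mul1r fg.
by case: fL => mf _ _; apply: eq_measurable_fun mf => x /set_mem; exact: fg.
Qed.

Lemma L2_potential b (e : R) f : admissible b -> 0 < e <= 1 -> L2 b f ->
  L2 b (potential e \o f).
Proof.
move=> ab e01 fL; have [mf _ pf] := fL.
apply: (L2_le (C := e^-1) ab _ _ _ fL).
- apply: (@measurableT_comp _ _ _ _ _ _ (potential e)) => //.
  apply: measurable_funB; first exact: measurable_cst.
  apply: measurable_funM; first exact: measurable_cst.
  apply: continuous_measurable_fun => s.
  apply: cvgV.
    by case/andP: e01 => e0 _; rewrite gt_eqF // saturate_den_gt0 // ltW.
  apply: cvgD; first exact: cvg_cst.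
  by apply: cvgM; [exact: cvg_cst|exact: exprn_continuous].
- by move=> x _; exact: ler_potential.
- by case: b pf {ab fL mf} => // pf x j; rewrite /= pf.
Qed.

Lemma L2_saturate_mul b (e : R) f g : admissible b -> 0 < e <= 1 ->
  L2 b f -> L2 b g -> L2 b (fun x => saturate e (f x) * g x).
Proof.
move=> ab e01 [mf _ pf] gL; have [mg _ pg] := gL.
have e0 : 0 < e by case/andP: e01.
apply: (L2_le (C := e^-1) ab _ _ _ gL).
- by apply: measurable_funM => //; exact: measurable_saturate.
- by move=> x _; rewrite normrM ler_wpM2r // saturate_bounded.
- by case: b pf pg {ab gL mf mg} => // pf pg x j; rewrite pf pg.
Qed.

Lemma smooth_potential b (e : R) f : admissible b -> 0 < e ->
  smooth b f -> smooth b (potential e \o f).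
Proof.
move=> /open_carrier; case: b => [|Omega] /= oU e0; last exact: smooth_on_potential.
move=> [sf pf]; split; first exact: smooth_on_potential.
by move=> x j; rewrite /= pf.
Qed.

Lemma dpartial_potential b (e : R) f i x : 0 < e -> smooth b f ->
  carrier b x -> dpartial [:: i] (potential e \o f) x =
  saturate e (f x) * dpartial [:: i] f x.
Proof.
move=> e0 /smooth_carrier sf bx; apply: derive_potential => //.
by have [_] := sf [::] x bx; apply.
Qed.

(** The chain rule; only the derivatives of order at most 1 are meaningful. *)
Definition potential_jet (e : R) f (D : seq 'I_d -> E -> R) (a : seq 'I_d) :
    E -> R :=
  if a is [::] then potential e \o f else fun x => saturate e (f x) * D a x.

Lemma l2norm_eq b f g : (forall x, region b x -> f x = g x) ->
  l2norm (leb d) (region b) f = l2norm (leb d) (region b) g.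
Proof.
by move=> fg; congr Num.sqrt; apply: eq_Rintegral => x /set_mem bx; rewrite fg.
Qed.

(** If smooth functions [phi_k] approximate [f] in [H^1], then [potential e] of
    [phi_k] is smooth and approximates [potential e \o f], since [potential e]
    is Lipschitz and its derivative [saturate e] is bounded and Lipschitz. *)
Lemma Hm_jet_potential b (e : R) f (D : seq 'I_d -> E -> R) :
  admissible b -> 0 < e <= 1 -> Hm_jet b 1 f D ->
  Hm_jet b 1 (potential e \o f) (potential_jet e f D).
Proof.
move=> ab e01 [Df DL [phi [sphi cphi]]].
have mb := measurable_region ab; have e0 : 0 < e by case/andP: e01.
have fL : L2 b f by rewrite -Df; exact: DL.
have phiL k : L2 b (phi k) by have [/(_ k)] := cphi [::] isT.
have cf : cvg_L2 b phi f by rewrite -Df; have [_] := cphi [::] isT.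
split=> //.
  case=> [_|i [|//] i1]; first exact: L2_potential.
  by apply: L2_saturate_mul => //; exact: DL.
exists (fun k => potential e \o phi k); split.
  by move=> k; exact: smooth_potential.
case=> [_|i [|//] i1].
  split=> [k|]; first exact: L2_potential.
  have cf' : (fun k => e^-1 * l2norm (leb d) (region b) (phi k - f))
      @ \oo --> (0 : R).
    by rewrite -[X in _ --> X](mulr0 e^-1); apply: cvgM cf; exact: cvg_cst.
  apply: (squeeze_cvgr _ (cvg_cst 0) cf'); near=> k.
  rewrite l2norm_ge0 /=; apply: (ler_l2norm mb).
  - by rewrite invr_ge0 ltW.
  - by apply: (sqintB mb); exact: L2_sqint.
  - by apply: (sqintB mb); apply: L2_sqint; exact: L2_potential.
  - by move=> x _; exact: potential_lipschitz.
have [dL dcvg] := cphi [:: i] i1; have DiL := DL [:: i] i1.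
split=> [k|].
  apply: (L2_eq ab _ (L2_saturate_mul ab e01 (phiL k) (dL k))) => x bx.
  by rewrite (dpartial_potential i e0 (sphi k) bx).
rewrite /cvg_L2 (_ : (fun k => _) = fun k => l2norm (leb d) (region b)
    ((fun x => saturate e (phi k x) * dpartial [:: i] (phi k) x) -
     (fun x => saturate e (f x) * D [:: i] x))); last first.
  apply/funext => k; apply: l2norm_eq => x /region_carrier bx.
  by rewrite !fctE (dpartial_potential i e0 (sphi k) bx).
apply: (@cvg_l2_bounded_mul _ _ _ _ _ mb e^-1 4) => //.
- by rewrite invr_ge0 ltW.
- by apply: continuous_measurable_fun; exact: continuous_saturate.
- by move=> s; exact: saturate_bounded.
- by move=> s t; exact: saturate_lipschitz.
- by move=> k; exact: L2_sqint.
- exact: L2_sqint.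
- by move=> k; exact: L2_sqint.
- exact: L2_sqint.
Unshelve. all: by end_near. Qed.

(** * Orthogonality of the convection term and energy decay *)

(** On a bounded domain this is the vanishing of the normal trace.  On the torus
    the smooth periodic functions are test functions for the divergence, and the
    identity passes to their [H^1] limits. *)
Lemma solenoidal_orthogonal_gradient b w g (D : seq 'I_d -> E -> R) :
  admissible b -> dotL2 b w -> Hm_jet b 1 g D ->
  \sum_(i < d) ip b (Defs.comp i w) (D [:: i]) = 0.
Proof.
move=> ab; have mb := measurable_region ab.
case: b ab mb => [|Omega] ab mb [wL dw zw] gD; last exact: zw gD.
case: gD => [_ DL [phi [sphi cphi]]].
pose s k := \sum_(i < d) ip (@Torus R d) (dpartial [:: i] (phi k)) (Defs.comp i w).
have s0 : s = fun=> 0.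
  apply/funext => k; rewrite -[RHS](dw (phi k) (sphi k)).
  by apply: eq_bigr => i _; exact: l2dotC.
have : s @ \oo --> \sum_(i < d) ip (@Torus R d) (D [:: i]) (Defs.comp i w).
  apply: cvg_big => [|i _]; first exact: add_continuous.
  have [dL dcvg] := cphi [:: i] isT.
  apply: (cvg_l2dot mb) => //; [exact: L2_sqint| |]; last by move=> k; exact: L2_sqint.
  by apply: L2_sqint; exact: DL.
rewrite s0 => /(cvg_unique (@Rhausdorff R)) /(_ (cvg_cst 0)) h.
by rewrite -[RHS]h; apply: eq_bigr => i _; exact: l2dotC.
Qed.

(** [saturate e (f) grad f] is the gradient of an [H^1] function, hence
    orthogonal to [w]; square integrability of [w . grad f] lets [e] go to 0. *)
Lemma transport_energy0 b w f (D : seq 'I_d -> E -> R) :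
  admissible b -> dotL2 b w -> Hm_jet b 1 f D ->
  L2 b (fun x => \sum_(j < d) w x ord0 j * D [:: j] x) ->
  ip b (fun x => \sum_(j < d) w x ord0 j * D [:: j] x) f = 0.
Proof.
move=> ab sw fD; set c := fun x => _ => cL; have mb := measurable_region ab.
have [Df DL _] := fD; have fL : L2 b f by rewrite -Df; exact: DL.
have sf := L2_sqint fL; have sc := L2_sqint cL.
have e0 n : 0 < (n.+1%:R^-1 : R) by rewrite invr_gt0.
have test0 n : l2dot (leb d) (region b) (saturate n.+1%:R^-1 \o f) c = 0.
  have := solenoidal_orthogonal_gradient ab sw
    (Hm_jet_potential ab (harmonic_le1 R n) fD) => <-.
  rewrite -(Rintegral_sum mb).
    by apply: eq_Rintegral => x _; rewrite mulr_sumr; apply: eq_bigr => j _;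
      rewrite /comp /= mulrCA.
  move=> i; apply: (sqintM mb); first by case: sw => wL _ _; exact: L2_sqint.
  by apply: L2_sqint; apply: L2_saturate_mul (harmonic_le1 R n) fL _ => //; exact: DL.
have := cvg_l2dot mb sc sf (fun n => sqint_saturate mb (e0 n) sf)
  (cvg_l2_saturate mb sf).
rewrite (_ : (fun k => _) = fun=> 0); last by apply/funext => n; exact: test0.
move=> /(cvg_unique (@Rhausdorff R)) /(_ (cvg_cst 0)) h.
by rewrite -[RHS]h; exact: l2dotC.
Qed.

Lemma vip_ler b v w : admissible b -> vL2 b v -> vL2 b w ->
  2 * vip b w v <= vip b w w + vip b v v.
Proof.
move=> ab vL wL; have mb := measurable_region ab.
rewrite /vip mulr_sumr -big_split; apply: ler_sum => i _ /=.
(* Expansion of [|w_i - v_i|^2 >= 0]. *)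
have := l2dotDZ mb (-1) (L2_sqint (wL i)) (L2_sqint (vL i)).
have := l2dot_ge0 (leb d) (region b)
  (Defs.comp i w + (fun x => -1 * Defs.comp i v x)).
rewrite /ip /l2dot; lra.
Qed.

Lemma vipDZl b (c : R) u p v : admissible b -> vL2 b u -> vL2 b p -> vL2 b v ->
  vip b (u + c *: p) v = vip b u v + c * vip b p v.
Proof.
move=> ab uL pL vL; have mb := measurable_region ab.
rewrite /vip mulr_sumr -big_split; apply: eq_bigr => i _ /=.
have sv := L2_sqint (vL i); have su := L2_sqint (uL i).
have sp := L2_sqint (pL i).
rewrite /ip -/(l2dot (leb d) (region b) _ _) -(l2dotZl mb c sp sv).
rewrite -(l2dotDl mb su (sqintZ mb c sp) sv).
by apply: eq_Rintegral => x _; rewrite /Defs.comp !fctE !mxE.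
Qed.

(** [(w . grad v, v) = 0], one component of [v] at a time. *)
Lemma convection_energy0 b w v (D : 'I_d -> seq 'I_d -> E -> R) :
  admissible b -> dotL2 b w -> (forall i, Hm_jet b 1 (Defs.comp i v) (D i)) ->
  vL2 b (convection w D) -> vip b (convection w D) v = 0.
Proof.
move=> ab sw vD cL; apply: big1 => i _.
have -> : Defs.comp i (convection w D) =
    fun x => \sum_(j < d) w x ord0 j * D i [:: j] x.
  by apply/funext => x; rewrite /Defs.comp mxE.
apply: (transport_energy0 ab sw (vD i)).
rewrite (_ : (fun x => _) = Defs.comp i (convection w D)) //.
by apply/funext => x; rewrite /Defs.comp mxE.
Qed.

(** The scheme tested against [v]: the projected convection term [p] and the
    convection term have the same inner product with the solenoidal field
    [v]. *)
Lemma scheme_step_energy b (tau : R) w v : admissible b -> dotL2 b w ->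
  scheme_step b tau w v -> vip b v v = vip b w v.
Proof.
move=> ab sw [sv v1 [D [p [vD [cL [pL _ _] cp] eqn]]]].
have [vL _ _] := sv.
have pv0 : vip b p v = 0.
  have := cp v sv.
  have -> : convection w D - p = convection w D + (-1) *: p by rewrite scaleN1r.
  by rewrite (vipDZl _ ab) // (convection_energy0 ab sw vD cL); lra.
by rewrite -(eqn v sv v1) (vipDZl _ ab) // pv0 mulr0 addr0.
Qed.

Lemma scheme_step_vnorm_le b (tau : R) w v : admissible b -> dotL2 b w ->
  scheme_step b tau w v -> vnorm b v <= vnorm b w.
Proof.
move=> ab sw step; apply: ler_wsqrtr.
have [wL _ _] := sw; have [[vL _ _] _ _] := step.
have := vip_ler ab vL wL; rewrite -(scheme_step_energy ab sw step); lra.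
Qed.

End energy.

Theorem mainTheorem3 (R : realType) (d : nat) (hd : d = 2%N \/ d = 3%N)
    (T mu : R) (hT : 0 < T) (hmu : 0 < mu)
    (b : flow_domain R d) (hb : admissible b)
    (N : nat) (t : nat -> R) (ht0 : t 0%N = 0) (htN : t N = T)
    (ht : forall n : nat, (1 <= n <= N)%N -> t n.-1 < t n)
    (S : R -> vfield R d -> vfield R d) (hS : stokes_semigroup b S)
    (u : nat -> vfield R d) (hu0 : dotL2 b (u 0%N))
    (hu : forall n : nat, (1 <= n <= N)%N ->
      let tau := t n - t n.-1 in
      scheme_step b tau (S (tau * mu) (u n.-1)) (u n)) :
  forall n : nat, (1 <= n <= N)%N -> vnorm b (u n) <= vnorm b (u n.-1).
Proof.
have su n : (n <= N)%N -> dotL2 b (u n).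
  by case: n => // n nN; have [] := hu n.+1 nN.
move=> n nN; have sn : dotL2 b (u n.-1).
  by apply: su; case/andP: nN => _; apply: leq_trans; exact: leq_pred.
have tau0 : 0 <= (t n - t n.-1) * mu.
  by rewrite mulr_ge0 ?ltW // subr_gt0 ht.
apply: le_trans (semigroup_contraction hS tau0 sn).
exact: scheme_step_vnorm_le hb (semigroup_dotL2 hS tau0 sn) (hu n nN).
Qed.
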